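(* Let $X_\ell, X_{\ell-1}$ be random vectors in $\mathbb{R}^m$ with $\|X_\ell\|_2 = \|X_{\ell-1}\|_2 = 1$ almost surely, and let $Z$ be a square-integrable random vector in $\mathbb{R}^d$. Let $\rho(x,y) = 1 - \frac{\langle x, y\rangle}{\|x\|\|y\|}$, let $\epsilon>0$ with $\mathbb{E}[\rho(X_\ell, X_{\ell-1})] < \frac{\epsilon}{2}$, and assume $h(x,y) = \mathbb{E}[Z \mid X_\ell = x, X_{\ell-1} = y]$ is $\alpha$-Lipschitz in its first argument and $\beta$-Lipschitz in its second. Let $f^*_\ell(x) = \mathbb{E}[Z\mid X_\ell = x]$ and $f^*_{\ell-1}(x) = \mathbb{E}[Z \mid X_{\ell-1} = x]$, and let $\hat f_\ell, \hat f_{\ell-1}$ be arbitrary measurable functions (e.g. finite-sample estimates of $f^*_\ell, f^*_{\ell-1}$). Define $\eta_\ell = \mathbb{E}[\|\hat f_\ell(X_\ell) - f^*_\ell(X_\ell)\|_2^2]$ and $\eta_{\ell-1} = \mathbb{E}[\|\hat f_{\ell-1}(X_{\ell-1}) - f^*_{\ell-1}(X_{\ell-1})\|_2^2]$. Then $$\mathbb{E}\big[\|\hat f_\ell(X_\ell) - \hat f_{\ell-1}(X_{\ell-1})\|_2^2\big] < 3\eta_\ell + 3\eta_{\ell-1} + 6(\alpha^2+\beta^2)\epsilon.$$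
   Context: Lipschitz conditions are with respect to Euclidean norms; conditional expectations are the usual ones.
   Formalization: The formal theorem assumes that α and β are nonnegative and not both zero and that both η's are finite; otherwise the strict inequality can fail (both sides 0 when α=β=0 and the estimates equal f*, or both sides infinite). *)

(* Defs.v *)
From HB Require Import structures.
From mathcomp Require Import all_boot all_order all_algebra.
From mathcomp Require Import all_classical all_reals all_analysis.
Set Implicit Arguments. Unset Strict Implicit. Unset Printing Implicit Defensive.
Import Order.TTheory GRing.Theory Num.Theory.
Local Open Scope classical_set_scope.
Local Open Scope ring_scope.

(* Vectors of R^n are represented as n.-tuple R, which MathComp-Analysis
   equips with the product (= Borel) sigma-algebra. *)

Definition eucl_dot (R : realType) (n : nat) (u v : n.-tuple R) : R :=
  \sum_(i < n) tnth u i * tnth v i.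
Definition eucl_norm (R : realType) (n : nat) (u : n.-tuple R) : R :=
  Num.sqrt (eucl_dot u u).
Definition eucl_sqdist (R : realType) (n : nat) (u v : n.-tuple R) : R :=
  \sum_(i < n) (tnth u i - tnth v i) ^+ 2.
Definition eucl_dist (R : realType) (n : nat) (u v : n.-tuple R) : R :=
  Num.sqrt (eucl_sqdist u v).

Definition rho (R : realType) (n : nat) (x y : n.-tuple R) : R :=
  1 - eucl_dot x y / (eucl_norm x * eucl_norm y).

Definition sq_integrable_rv (dT : measure_display) (T : measurableType dT)
    (R : realType) (P : probability T R) (n : nat) (Z : T -> n.-tuple R) :=
  measurable_fun setT Z /\
  (\int[P]_t ((eucl_norm (Z t)) ^+ 2)%:E < +oo)%E.

Definition is_cond_exp (dT : measure_display) (T : measurableType dT)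
    (R : realType) (P : probability T R)
    (dV : measure_display) (V : measurableType dV) (n : nat)
    (Z : T -> n.-tuple R) (Y : T -> V) (g : V -> n.-tuple R) : Prop :=
  measurable_fun setT g /\
  forall i : 'I_n,
    P.-integrable setT (fun t => (tnth (g (Y t)) i)%:E) /\
    forall B : set V, measurable B ->
      (\int[P]_(t in Y @^-1` B) (tnth (Z t) i)%:E =
       \int[P]_(t in Y @^-1` B) (tnth (g (Y t)) i)%:E)%E.

(* Main.v *)
(** Write [W = h(X_l, X_(l-1))].  By the tower property [f*_l(X_l)] is the
    conditional expectation of [W] given [X_l], hence the best mean-square
    approximation of [W] among the functions of [X_l]; comparing it with
    [h(X_l, X_l)] bounds [E|f*_l(X_l) - W|^2] by [beta^2 E|X_l - X_(l-1)|^2].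
    Symmetrically, [h(X_(l-1), X_(l-1))] gives
    [E|f*_(l-1)(X_(l-1)) - W|^2 <= alpha^2 E|X_l - X_(l-1)|^2].  On the unit
    sphere [|x - y|^2 = 2 rho(x, y)], so the last expectation is below [eps],
    and [|a - d|^2 <= 3|a - b|^2 + 3|c - d|^2 + 6|b - w|^2 + 6|c - w|^2]
    concludes.  Best approximation is proved first on the events where the two
    competing functions are bounded, so that the orthogonality relation only
    involves a bounded factor, and then passes to the limit. *)

Require Import Defs.
From HB Require Import structures.
From mathcomp Require Import all_boot all_order all_algebra.
From mathcomp Require Import ring lra.
From mathcomp Require Import all_classical all_reals all_analysis measurable_realfun.
Set Implicit Arguments.
Unset Strict Implicit.
Import Order.TTheory GRing.Theory Num.Theory.
Local Open Scope classical_set_scope.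
Local Open Scope ring_scope.

(** * Best mean-square approximation by functions of [Y], scalar case *)

Section best_approximation.
Context {dT : measure_display} {T : measurableType dT} {R : realType}.
Context {mu : {measure set T -> \bar R}}.

Lemma integrable_mul_bounded (E : set T) (D phi : T -> R) (c : R) :
  mu.-integrable E (EFin \o D) -> measurable_fun E phi ->
  measurable E -> (forall t, E t -> `|phi t| <= c) ->
  mu.-integrable E (EFin \o (fun t => D t * phi t)).
Proof.
move=> iD mphi mE phic.
apply: (@integrableMl _ _ _ mu E mE (EFin \o D) phi iD mphi).
exists c; split; first exact: num_real.
by move=> x cx t Et /=; exact: le_trans (phic t Et) (ltW cx).
Qed.

Context {dV : measure_display} {V : measurableType dV}.
Variables (Y : T -> V) (mY : measurable_fun setT Y).

Let mpre {B : set V} : measurable B -> measurable (Y @^-1` B).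
Proof. by move=> mB; rewrite -[_ @^-1` _]setTI; exact: mY. Qed.

Section orthogonality.
Variable D : T -> R.
Hypothesis iD : mu.-integrable setT (EFin \o D).
(** This encodes that [D] has zero conditional expectation given [Y]; it is applied to
    [D = 2 * (W - f(Y))]. *)
Hypothesis D0 : forall B : set V, measurable B ->
  \int[mu]_(t in Y @^-1` B) D t = 0.
Variable phi : V -> R.
Hypothesis mphi : measurable_fun setT phi.

Let mphiY (E : set T) : measurable_fun E (fun t => phi (Y t)).
Proof. exact/measurable_funTS/measurableT_comp. Qed.

Let iDE {E : set T} : measurable E -> mu.-integrable E (EFin \o D).
Proof. by move=> mE; exact: integrableS iD. Qed.

(* Halving the range of phi by splitting B replaces an approximation by simple
   functions. *)
Let Rintegral_mul_le (delta : R) (n : nat) (a : R) (B : set V) :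
  measurable B -> (forall x, B x -> a <= phi x <= a + 2 ^+ n * delta) ->
  `|\int[mu]_(t in Y @^-1` B) (D t * phi (Y t))| <=
    delta * \int[mu]_(t in Y @^-1` B) `|D t|.
Proof.
elim: n a B => [|n IH] a B mB phiB.
  set E := Y @^-1` B; have mE : measurable E by exact: mpre.
  have iDphi : mu.-integrable E (EFin \o (fun t => D t * (phi (Y t) - a))).
    apply: (@integrable_mul_bounded _ _ _ delta) => //; first exact: iDE.
      exact: measurable_funB.
    by move=> t /phiB /andP[? ?]; rewrite ger0_norm; lra.
  (* [D] has zero integral over [E], so shifting [phi] by the constant [a] changes nothing and
     leaves a factor in [[0, delta]]. *)
  have -> : \int[mu]_(t in E) (D t * phi (Y t)) =
            \int[mu]_(t in E) (D t * (phi (Y t) - a)).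
    transitivity (\int[mu]_(t in E) (D t * (phi (Y t) - a) + a * D t)).
      by apply: eq_Rintegral => t _; ring.
    rewrite RintegralD//; last exact: (integrableZl mE a (iDE mE)).
    by rewrite RintegralZl ?D0 ?mulr0 ?addr0//; exact: iDE.
  apply: le_trans (le_normr_Rintegral mE iDphi) _.
  rewrite -RintegralZl//; last exact: integrable_norm (iDE mE).
  apply: le_Rintegral => //.
  - exact: integrable_norm iDphi.
  - exact: (integrableZl mE delta (integrable_norm (iDE mE))).
  - move=> t /phiB /andP[pa pb]; rewrite normrM mulrC ler_wpM2r//.
    by rewrite ger0_norm; lra.
have [d0|d0] := ltP delta 0.
  have -> : B = set0.
    have n0 : 0 < 2 ^+ n.+1 :> R by rewrite exprn_gt0.
    by rewrite -subset0 => x /phiB /andP[? ?]; nra.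
  by rewrite preimage_set0 !Rintegral_set0 normr0 mulr0.
(* The two halves of the range have width [2 ^+ n * delta] each. Their preimages are disjoint, so
   the bounds add up to [delta] times the integral of [|D|] over the whole preimage of [B], with no
   loss in [n]. *)
set mid := a + 2 ^+ n * delta.
set L := B `&` phi @^-1` `]-oo, mid].
set H := B `&` phi @^-1` `]mid, +oo[.
have mL : measurable L.
  by apply: measurableI => //; rewrite -[_ @^-1` _]setTI; exact: mphi.
have mH : measurable H.
  by apply: measurableI => //; rewrite -[_ @^-1` _]setTI; exact: mphi.
have BE : Y @^-1` B = Y @^-1` L `|` Y @^-1` H.
  rewrite -preimage_setU -setIUr; congr (_ @^-1` _).
  rewrite -preimage_setU; apply/esym/setIidPl => x _ /=.
  by rewrite !in_itv/= andbT; have [?|?] := leP (phi x) mid; [left|right].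
have dLH : [disjoint Y @^-1` L & Y @^-1` H].
  apply/disj_setPS => t [[_ /=]] + [_ /=].
  by rewrite !in_itv/= andbT => /le_lt_trans /[apply]; rewrite ltxx.
have iDphi : mu.-integrable (Y @^-1` B) (EFin \o (fun t => D t * phi (Y t))).
  apply: (@integrable_mul_bounded _ _ _ (`|a| + 2 ^+ n.+1 * delta)) => //.
  - exact/iDE/mpre.
  - exact: mpre.
  - move=> t /phiB /andP[? ?]; have := ler_norm a; have := ler_norm (- a).
    rewrite normrN => ? ?; rewrite ler_norml; apply/andP; split; lra.
have iDn := integrable_norm (iDE (mpre mB)).
rewrite BE !Rintegral_setU -?BE//; [|exact: mpre..].
rewrite mulrDr (le_trans (ler_normD _ _))// lerD//.
- apply: (IH a) => // x [/phiB /andP[pa _] /=].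
  by rewrite in_itv/= pa.
- apply: (IH mid) => // x [/phiB /andP[_ pa] /=].
  rewrite in_itv/= andbT => /ltW ->; move: pa; rewrite /mid exprS; lra.
Qed.

(** The previous bound does not depend on [n]: for any [delta > 0], a large [n] makes
    [2 ^+ n * delta] exceed the width [2 * c] of the range [[-c, c]], and [delta] can then be
    arbitrarily small. *)
Lemma Rintegral_mul_bounded_eq0 (c : R) (B : set V) :
  measurable B -> (forall x, B x -> `|phi x| <= c) ->
  \int[mu]_(t in Y @^-1` B) (D t * phi (Y t)) = 0.
Proof.
move=> mB phic; apply/eqP; rewrite -normr_le0.
set M := \int[mu]_(t in Y @^-1` B) `|D t|.
have M0 : 0 <= M by exact: Rintegral_ge0.
apply/ler_addgt0Pr => e e0; rewrite add0r.
have M10 : 0 < M + 1 by lra.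
(* Dividing by [M + 1] covers the case [M = 0]. *)
pose delta := e / (M + 1); have delta0 : 0 < delta by exact: divr_gt0.
have [n] : exists n, 2 * c / delta < 2 ^+ n.
  by exists (Num.bound (2 * c / delta)); apply: upper_nthrootP.
rewrite ltr_pdivrMr// => cn.
have dM : delta * M <= e.
  by rewrite /delta mulrAC ler_pdivrMr// ler_pM2l// lerDl.
apply: le_trans dM; apply: (@Rintegral_mul_le delta n (- c)) => //.
clearbody delta => x /phic; rewrite ler_norml => /andP[-> xc] /=.
by apply: le_trans xc _; rewrite addrC lerBrDr -mulr2n -[leLHS]mulr_natl ltW.
Qed.

End orthogonality.

Section minimality.
Variables (W : T -> R) (f : V -> R).
Hypotheses (iW : mu.-integrable setT (EFin \o W)) (mf : measurable_fun setT f).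
Hypothesis ifY : mu.-integrable setT (EFin \o (f \o Y)).
Hypothesis Wf : forall B : set V, measurable B ->
  (\int[mu]_(t in Y @^-1` B) (W t)%:E = \int[mu]_(t in Y @^-1` B) (f (Y t))%:E)%E.
Variables (k : V -> R) (mk : measurable_fun setT k).

Let mW : measurable_fun setT W.
Proof. exact/measurable_EFinP/(measurable_int mu iW). Qed.

Let mfYW (g : V -> R) (E : set T) : measurable_fun setT g ->
  measurable_fun E (fun t => ((g (Y t) - W t) ^+ 2)%:E).
Proof.
move=> mg; apply/measurable_EFinP/measurable_funTS/measurable_funX.
by apply: measurable_funB => //; exact: measurableT_comp.
Qed.

Let le_integral_bounded (c : R) (B : set V) : measurable B ->
  (forall x, B x -> `|f x| <= c /\ `|k x| <= c) ->
  (\int[mu]_(t in Y @^-1` B) ((f (Y t) - W t) ^+ 2)%:E <=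
   \int[mu]_(t in Y @^-1` B) ((k (Y t) - W t) ^+ 2)%:E)%E.
Proof.
move=> mB fkc; set E := Y @^-1` B; have mE : measurable E by exact: mpre.
(* Once the infinite case is set aside, the squared error of [k] is integrable and can be added to
   the cross term. *)
have [->|vfin] := eqVneq (\int[mu]_(t in E) ((k (Y t) - W t) ^+ 2)%:E)%E +oo%E.
  by rewrite leey.
pose D t := 2 * (W t - f (Y t)).
have iWf : mu.-integrable setT (EFin \o (fun t => W t - f (Y t))).
  exact: (integrableB measurableT iW ifY).
have iD : mu.-integrable setT (EFin \o D) by exact: (integrableZl measurableT 2 iWf).
have D0 (B' : set V) : measurable B' -> \int[mu]_(t in Y @^-1` B') D t = 0.
  move=> mB'; have mE' := mpre mB'.
  rewrite RintegralZl//; last exact: integrableS iWf.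
  rewrite RintegralB//; last 2 first.
  - exact: integrableS iW.
  - exact: integrableS ifY.
  by rewrite /Rintegral Wf// subrr mulr0.
have mkf : measurable_fun setT (fun x => k x - f x) by exact: measurable_funB.
have kfc x : B x -> `|k x - f x| <= c + c.
  by move=> /fkc[fc kc]; rewrite (le_trans (ler_normB _ _))// lerD.
have iDkf : mu.-integrable E (EFin \o (fun t => D t * (k (Y t) - f (Y t)))).
  apply: (@integrable_mul_bounded _ _ _ (c + c)) => //.
  - exact: integrableS iD.
  - apply/measurable_funTS; exact: (measurableT_comp mkf mY).
  - by move=> t /kfc.
have iv : mu.-integrable E (fun t => ((k (Y t) - W t) ^+ 2)%:E).
  apply/integrableP; split; first exact: mfYW.
  under eq_integral do rewrite gee0_abs ?lee_fin ?sqr_ge0//.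
  by rewrite ltey.
have Dkf0 : (\int[mu]_(t in E) (D t * (k (Y t) - f (Y t)))%:E = 0)%E.
  rewrite -[LHS]fineK; last exact: (integrable_fin_num mE iDkf).
  by congr EFin; exact: (Rintegral_mul_bounded_eq0 iD D0 mkf mB kfc).
(* Adding the cross term, of zero integral, makes the comparison pointwise: [(k - W)^2 + D (k - f) =
   (f - W)^2 + (k - f)^2]. *)
rewrite -[leRHS]adde0 -[in leRHS]Dkf0 -(integralD mE iv iDkf).
apply: ge0_le_integral => //.
- by move=> t _; rewrite lee_fin sqr_ge0.
- exact: mfYW.
- by apply: emeasurable_funD; [exact: (measurable_int mu iv)|exact: (measurable_int mu iDkf)].
- move=> t _; rewrite -EFinD lee_fin /D.
  have := sqr_ge0 (k (Y t) - f (Y t)); rewrite !expr2; nra.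
Qed.

(** The sets where [|f|] and [|k|] are at most [n] exhaust [V]. The left integral is the limit of
    its restrictions by monotone convergence, and each restricted right integral is at most the full
    one. *)
Lemma cond_exp_sqdist_min :
  (\int[mu]_t ((f (Y t) - W t) ^+ 2)%:E <=
   \int[mu]_t ((k (Y t) - W t) ^+ 2)%:E)%E.
Proof.
pose sub (g : V -> R) (n : nat) : set V := [set x | `|g x| <= n%:R].
have msub g n : measurable_fun setT g -> measurable (sub g n).
  move=> mg; rewrite (_ : sub g n = setT `&` (fun x => `|g x|) @^-1` `]-oo, n%:R]).
    have : measurable_fun setT (fun x => `|g x|) by exact: measurableT_comp.
    exact.
  by rewrite setTI; apply/funext => x /=; rewrite in_itv.
pose B n := sub f n `&` sub k n.
have mB n : measurable (B n) by apply: measurableI; exact: msub.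
pose F n := Y @^-1` B n.
have FT : \bigcup_n F n = setT.
  apply/seteqP; split => // t _.
  pose s := Num.bound (`|f (Y t)| + `|k (Y t)|).
  have : `|f (Y t)| + `|k (Y t)| < s%:R by exact/archi_boundP/addr_ge0.
  have := normr_ge0 (f (Y t)); have := normr_ge0 (k (Y t)) => k0 f0 fks.
  by exists s => //; split; apply/ltW/(le_lt_trans _ fks); lra.
have ndF : nondecreasing_seq F.
  move=> i j ij; rewrite subsetEset => t [fi ki].
  have ij' : i%:R <= j%:R :> R by rewrite ler_nat.
  by split; [exact: le_trans fi ij'|exact: le_trans ki ij'].
have := @ge0_nondecreasing_set_cvg_integral _ _ _ F
  (fun t => ((f (Y t) - W t) ^+ 2)%:E) mu ndF (fun n => mpre (mB n))
  (fun n => mfYW mf).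
have f0 i x : F i x -> (0%R <= ((f (Y x) - W x) ^+ 2)%:E)%E.
  by rewrite lee_fin sqr_ge0.
move=> /(_ f0); rewrite FT => cvgF.
rewrite -(cvg_lim _ cvgF)//; apply: lime_le; first by apply/cvg_ex; eexists; exact: cvgF.
near=> n; apply: (@le_trans _ _ (\int[mu]_(t in F n) ((k (Y t) - W t) ^+ 2)%:E)%E).
  by apply: (@le_integral_bounded n%:R) => // x [].
apply: ge0_subset_integral => //; [exact: mpre|exact: mfYW|].
by move=> t _; rewrite lee_fin sqr_ge0.
Unshelve. all: by end_near. Qed.

End minimality.
End best_approximation.

(** * Euclidean geometry, measurability, and the integral of [rho] *)

Section euclidean.
Context {R : realType} {n : nat}.
Implicit Types u v w : n.-tuple R.

Lemma eucl_sqdist_ge0 u v : 0 <= eucl_sqdist u v.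
Proof. by apply: sumr_ge0 => i _; exact: sqr_ge0. Qed.

Lemma eucl_dot_ge0 u : 0 <= eucl_dot u u.
Proof. by apply: sumr_ge0 => i _; rewrite -expr2 sqr_ge0. Qed.

Lemma eucl_sqdistC u v : eucl_sqdist u v = eucl_sqdist v u.
Proof. by apply: eq_bigr => i _; rewrite -sqrrN opprB. Qed.

Lemma eucl_sqdist_lipschitz p (u v : n.-tuple R) (x y : p.-tuple R) (c : R) :
  0 <= c -> eucl_dist u v <= c * eucl_dist x y ->
  eucl_sqdist u v <= c ^+ 2 * eucl_sqdist x y.
Proof.
move=> c0; rewrite -ler_sqr ?nnegrE ?sqrtr_ge0 ?mulr_ge0 ?sqrtr_ge0//.
rewrite exprMn !sqr_sqrtr// ?eucl_sqdist_ge0//.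
by apply: sumr_ge0 => i _; exact: sqr_ge0.
Qed.

(** Expand the square: [|u - v|^2 = |u|^2 + |v|^2 - 2 <u, v>]. *)
Lemma rho_unit u v : eucl_norm u = 1 -> eucl_norm v = 1 ->
  rho u v = eucl_sqdist u v / 2.
Proof.
move=> u1 v1; rewrite /rho u1 v1 mulr1 divr1.
have norm1 w : eucl_norm w = 1 -> eucl_dot w w = 1.
  by move=> w1; rewrite -[LHS]sqr_sqrtr ?eucl_dot_ge0// -/(eucl_norm w) w1 expr1n.
have -> : eucl_sqdist u v = eucl_dot u u + eucl_dot v v - 2 * eucl_dot u v.
  rewrite /eucl_sqdist /eucl_dot mulr_sumr -sumrN -!big_split/=.
  by apply: eq_bigr => i _; ring.
by rewrite !norm1//; field.
Qed.

Lemma eucl_sqdist_chain (a b c d w : n.-tuple R) :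
  eucl_sqdist a d <= 3 * eucl_sqdist a b + 3 * eucl_sqdist d c +
    (6 * eucl_sqdist b w + 6 * eucl_sqdist c w).
Proof.
rewrite /eucl_sqdist !mulr_sumr -!big_split/=; apply: ler_sum => i _.
move: (tnth a i) (tnth b i) (tnth c i) (tnth d i) (tnth w i) => {}a {}b {}c {}d {}w.
(* The squares of the pairwise differences of [a - b], [b - c], [c - d] give [(a - d)^2 <= 3 ((a -
   b)^2 + (b - c)^2 + (c - d)^2)]. The fourth square gives [(b - c)^2 <= 2 (b - w)^2 + 2 (c - w)^2],
   whence the factor 6. *)
have := sqr_ge0 ((a - b) - (b - c)); have := sqr_ge0 ((a - b) - (c - d)).
have := sqr_ge0 ((b - c) - (c - d)); have := sqr_ge0 ((b - w) + (c - w)).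
rewrite !expr2; nra.
Qed.

Context {dT : measure_display} {T : measurableType dT}.
Implicit Types X Y : T -> n.-tuple R.

Lemma measurable_tnth_comp X i : measurable_fun setT X ->
  measurable_fun setT (fun t => tnth (X t) i).
Proof. by move=> mX; exact: measurableT_comp (measurable_tnth i) mX. Qed.

Lemma measurable_eucl_sqdist X Y : measurable_fun setT X ->
  measurable_fun setT Y -> measurable_fun setT (fun t => eucl_sqdist (X t) (Y t)).
Proof.
move=> mX mY; apply: measurable_sum => i; apply: measurable_funX.
by apply: measurable_funB; exact: measurable_tnth_comp.
Qed.

Lemma measurable_eucl_dot X Y : measurable_fun setT X ->
  measurable_fun setT Y -> measurable_fun setT (fun t => eucl_dot (X t) (Y t)).
Proof.
move=> mX mY; apply: measurable_sum => i.
by apply: measurable_funM; exact: measurable_tnth_comp.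
Qed.

(* Square root and inverse are handled as real powers, whose measurability is
   known; this is legitimate because norms are nonnegative. *)
Lemma measurable_rho X Y : measurable_fun setT X ->
  measurable_fun setT Y -> measurable_fun setT (fun t => rho (X t) (Y t)).
Proof.
have mnorm (U : T -> n.-tuple R) : measurable_fun setT U ->
    measurable_fun setT (fun t => eucl_norm (U t)).
  move=> mU; rewrite (_ : (fun _ => _) =
      (fun t => eucl_dot (U t) (U t) `^ 2^-1)).
    by apply: (measurableT_comp (measurable_powR _)); exact: measurable_eucl_dot.
  by apply/funext => t; rewrite powR12_sqrt// eucl_dot_ge0.
move=> mX mY; apply: measurable_funB => //.
apply: measurable_funM; first exact: measurable_eucl_dot.
rewrite (_ : (fun _ => _) =
    (fun t => (eucl_norm (X t) * eucl_norm (Y t)) `^ (-1))).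
  apply: (measurableT_comp (measurable_powR _)).
  by apply: measurable_funM; exact: mnorm.
by apply/funext => t; rewrite powR_inv1// mulr_ge0// sqrtr_ge0.
Qed.

(** The pointwise identity holds only almost everywhere, so the integrands are exchanged by
    [ae_eq_integral], which requires [rho] to be measurable. *)
Lemma integral_rho_unit (mu : {measure set T -> \bar R}) X Y :
  measurable_fun setT X -> measurable_fun setT Y ->
  {ae mu, forall t, eucl_norm (X t) = 1} ->
  {ae mu, forall t, eucl_norm (Y t) = 1} ->
  (\int[mu]_t (eucl_sqdist (X t) (Y t))%:E =
   2%:E * \int[mu]_t (rho (X t) (Y t))%:E)%E.
Proof.
move=> mX mY X1 Y1; have mS := measurable_eucl_sqdist mX mY.
have -> : (\int[mu]_t (rho (X t) (Y t))%:E =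
           \int[mu]_t (2^-1%:E * (eucl_sqdist (X t) (Y t))%:E))%E.
  apply: ae_eq_integral => //.
  - exact/measurable_EFinP/measurable_rho.
  - by apply: measurable_funeM; exact/measurable_EFinP.
  - apply: filterS2 X1 Y1 => t Xt Yt _.
    by rewrite rho_unit// -EFinM mulrC.
rewrite ge0_integralZl//; last 2 first.
- exact/measurable_EFinP.
- by move=> t _; rewrite lee_fin eucl_sqdist_ge0.
by rewrite muleA -EFinM divff// mul1e.
Qed.

End euclidean.

(** * Tower property and best approximation for vectors *)

Section conditional_expectation.
Context {dT : measure_display} {T : measurableType dT} {R : realType}.
Context {P : probability T R} {dV : measure_display} {V : measurableType dV}.
Context {n : nat}.

Lemma is_cond_exp_tower {dU} {U : measurableType dU} (Z : T -> n.-tuple R)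
    (Y : T -> V) (p : V -> U) (h : V -> n.-tuple R) (f : U -> n.-tuple R) :
  measurable_fun setT p -> is_cond_exp P Z Y h ->
  is_cond_exp P Z (fun t => p (Y t)) f ->
  is_cond_exp P (fun t => h (Y t)) (fun t => p (Y t)) f.
Proof.
move=> mp [_ hP] [mf fP]; split => // i; split; first exact: (fP i).1.
move=> B mB; rewrite -(fP i).2//.
have mpB : measurable (p @^-1` B) by rewrite -[_ @^-1` _]setTI; exact: mp.
by have /esym := (hP i).2 _ mpB.
Qed.

(** The squared distance is a sum over coordinates, and the scalar inequality applies to each. *)
Lemma is_cond_exp_sqdist_min (Y : T -> V) (W : T -> n.-tuple R)
    (f k : V -> n.-tuple R) :
  measurable_fun setT Y -> measurable_fun setT W ->
  (forall i, P.-integrable setT (fun t => (tnth (W t) i)%:E)) ->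
  is_cond_exp P W Y f -> measurable_fun setT k ->
  (\int[P]_t (eucl_sqdist (f (Y t)) (W t))%:E <=
   \int[P]_t (eucl_sqdist (k (Y t)) (W t))%:E)%E.
Proof.
move=> mY mW iW [mf fP] mk.
have sumE (g : V -> n.-tuple R) : measurable_fun setT g ->
    (\int[P]_t (eucl_sqdist (g (Y t)) (W t))%:E =
     \sum_(i < n) \int[P]_t ((tnth (g (Y t)) i - tnth (W t) i) ^+ 2)%:E)%E.
  move=> mg; rewrite -ge0_integral_sum//.
  - by apply: eq_integral => t _; rewrite sumEFin.
  - move=> i; apply/measurable_EFinP/measurable_funX; apply: measurable_funB.
      by apply: measurable_tnth_comp; exact: measurableT_comp.
    exact: measurable_tnth_comp.
  - by move=> i t _; rewrite lee_fin sqr_ge0.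
rewrite !sumE//; apply: lee_sum => i _.
have [ifi fiP] := fP i.
apply: (@cond_exp_sqdist_min _ _ _ P _ _ Y mY (fun t => tnth (W t) i)
  (fun x => tnth (f x) i) (iW i) _ ifi fiP (fun x => tnth (k x) i)).
- exact: measurable_tnth_comp.
- exact: measurable_tnth_comp.
Qed.

End conditional_expectation.

(** * Assembly of the estimates *)

Unset Implicit Arguments.
Set Strict Implicit.

Theorem theorem2 (dT : measure_display) (T : measurableType dT)
  (R : realType) (P : probability T R) (m d : nat)
  (Xl Xl1 : T -> m.-tuple R) (Z : T -> d.-tuple R)
  (alpha beta eps : R)
  (h : (m.-tuple R * m.-tuple R)%type -> d.-tuple R)
  (fsl fsl1 fhl fhl1 : m.-tuple R -> d.-tuple R) :
  measurable_fun setT Xl -> measurable_fun setT Xl1 ->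
  {ae P, forall t, eucl_norm (Xl t) = 1} ->
  {ae P, forall t, eucl_norm (Xl1 t) = 1} ->
  sq_integrable_rv P Z ->
  0 < eps ->
  (\int[P]_t (rho (Xl t) (Xl1 t))%:E < (eps / 2)%:E)%E ->
  is_cond_exp P Z (fun t => (Xl t, Xl1 t)) h ->
  0 <= alpha -> 0 <= beta -> 0 < alpha + beta ->
  (forall x x' y, eucl_dist (h (x, y)) (h (x', y)) <= alpha * eucl_dist x x') ->
  (forall x y y', eucl_dist (h (x, y)) (h (x, y')) <= beta * eucl_dist y y') ->
  is_cond_exp P Z Xl fsl ->
  is_cond_exp P Z Xl1 fsl1 ->
  measurable_fun setT fhl -> measurable_fun setT fhl1 ->
  let eta_l := (\int[P]_t (eucl_sqdist (fhl (Xl t)) (fsl (Xl t)))%:E)%E in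
  let eta_l1 := (\int[P]_t (eucl_sqdist (fhl1 (Xl1 t)) (fsl1 (Xl1 t)))%:E)%E in
  (eta_l < +oo)%E -> (eta_l1 < +oo)%E ->
  (\int[P]_t (eucl_sqdist (fhl (Xl t)) (fhl1 (Xl1 t)))%:E
     < 3%:E * eta_l + 3%:E * eta_l1
       + (6 * (alpha ^+ 2 + beta ^+ 2) * eps)%:E)%E.
Proof.
move=> mX mY X1 Y1 _ eps0 rho_lt hW a0 b0 ab0 ha hb fX gY mfh mgh eta_l eta_l1.
move=> etal_fin etal1_fin.
have [mh hP] := hW.
have mXY : measurable_fun setT (fun t => (Xl t, Xl1 t)).
  exact: measurable_fun_pair.
pose W t := h (Xl t, Xl1 t).
have mW : measurable_fun setT W by exact: measurableT_comp.
have iW i : P.-integrable setT (fun t => (tnth (W t) i)%:E) := (hP i).1.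
have mdiag : measurable_fun setT (fun x => h (x, x)).
  apply: (measurableT_comp mh); exact: measurable_fun_pair.
have S0 (n : nat) (u v : n.-tuple R) : (0 <= (eucl_sqdist u v)%:E)%E.
  by rewrite lee_fin eucl_sqdist_ge0.
have mS (n : nat) (U V : T -> n.-tuple R) : measurable_fun setT U ->
    measurable_fun setT V ->
    measurable_fun setT (fun t => (eucl_sqdist (U t) (V t))%:E).
  by move=> mU mV; exact/measurable_EFinP/measurable_eucl_sqdist.
have lip (c : R) (k : T -> d.-tuple R) : 0 <= c -> measurable_fun setT k ->
    (forall t, eucl_dist (k t) (W t) <= c * eucl_dist (Xl t) (Xl1 t)) ->
    (\int[P]_t (eucl_sqdist (k t) (W t))%:E <=
     (c ^+ 2)%:E * \int[P]_t (eucl_sqdist (Xl t) (Xl1 t))%:E)%E.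
  move=> c0 mk kc; rewrite -ge0_integralZl//; [|exact: mS|by rewrite lee_fin sqr_ge0].
  apply: ge0_le_integral => //; first exact: mS.
    by apply: measurable_funeM; exact: mS.
  by move=> t _; rewrite -EFinM lee_fin eucl_sqdist_lipschitz.
have A_le := le_trans (is_cond_exp_sqdist_min mX mW iW
    (is_cond_exp_tower (p := fst) measurable_fst hW fX) mdiag)
  (lip beta _ b0 (measurableT_comp mdiag mX) (fun t => hb _ _ _)).
have B_le : (\int[P]_t (eucl_sqdist (fsl1 (Xl1 t)) (W t))%:E <=
    (alpha ^+ 2)%:E * \int[P]_t (eucl_sqdist (Xl t) (Xl1 t))%:E)%E.
  apply: le_trans (is_cond_exp_sqdist_min mY mW iW
    (is_cond_exp_tower (p := snd) measurable_snd hW gY) mdiag) _.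
  apply: (lip alpha _ a0 (measurableT_comp mdiag mY)) => t.
  (* Here the competitor replaces [Xl] by [Xl1] in the first argument, so [ha] yields the distance
     with its arguments swapped. *)
  by rewrite /eucl_dist (eucl_sqdistC (Xl t)); exact: ha.
have mfX : measurable_fun setT (fun t => fsl (Xl t)).
  exact: measurableT_comp fX.1 mX.
have mgY : measurable_fun setT (fun t => fsl1 (Xl1 t)).
  exact: measurableT_comp gY.1 mY.
have mfhX : measurable_fun setT (fun t => fhl (Xl t)) by exact: measurableT_comp mX.
have mghY : measurable_fun setT (fun t => fhl1 (Xl1 t)) by exact: measurableT_comp mY.
set A := (\int[P]_t (eucl_sqdist (fsl (Xl t)) (W t))%:E)%E in A_le.
set B := (\int[P]_t (eucl_sqdist (fsl1 (Xl1 t)) (W t))%:E)%E in B_le.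
have chain : (\int[P]_t (eucl_sqdist (fhl (Xl t)) (fhl1 (Xl1 t)))%:E <=
    3%:E * eta_l + 3%:E * eta_l1 + (6%:E * A + 6%:E * B))%E.
  have mZ (c : R) (U V : T -> d.-tuple R) : measurable_fun setT U ->
      measurable_fun setT V ->
      measurable_fun setT (fun t => c%:E * (eucl_sqdist (U t) (V t))%:E)%E.
    by move=> mU mV; apply: measurable_funeM; exact: mS.
  have Z0 (c : R) (u v : d.-tuple R) : 0 <= c ->
      (0 <= c%:E * (eucl_sqdist u v)%:E)%E.
    by move=> c0; rewrite mule_ge0.
  rewrite /eta_l /eta_l1 /A /B -!ge0_integralZl//; try exact: mS.
  rewrite -!ge0_integralD//; try (by move=> t _; rewrite ?adde_ge0 ?Z0);
    try exact: mZ; try (by apply: emeasurable_funD; exact: mZ).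
  apply: ge0_le_integral => //.
  - exact: mS.
  - by apply: emeasurable_funD; apply: emeasurable_funD; exact: mZ.
  - by move=> t _; rewrite -!EFinM -!EFinD lee_fin eucl_sqdist_chain.
have XY_lt : (\int[P]_t (eucl_sqdist (Xl t) (Xl1 t))%:E < eps%:E)%E.
  rewrite integral_rho_unit//.
  have -> : eps%:E = (2%:E * (eps / 2)%:E)%E by rewrite -EFinM mulrC divfK.
  by rewrite lte_pmul2l.
have int_fin n (U V : T -> n.-tuple R) (b : \bar R) :
    (\int[P]_t (eucl_sqdist (U t) (V t))%:E < b)%E ->
    (\int[P]_t (eucl_sqdist (U t) (V t))%:E)%E \is a fin_num.
  move=> Ub; rewrite ge0_fin_numE ?integral_ge0//.
  exact: lt_le_trans Ub (leey _).
apply: le_lt_trans chain _.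
(* Cancelling the [eta] terms from a strict inequality requires them to be finite. *)
rewrite lteD2lE; last first.
  by rewrite fin_numD !fin_numM// (int_fin _ _ _ _ etal_fin, int_fin _ _ _ _ etal1_fin).
move: A_le B_le (XY_lt); rewrite -(fineK (int_fin _ _ _ _ XY_lt)).
move: (fine _) => s; rewrite -!EFinM lte_fin => A_le B_le s_eps.
apply: (@le_lt_trans _ _ (6%:E * (beta ^+ 2 * s)%:E + 6%:E * (alpha ^+ 2 * s)%:E)%E).
  by apply: leeD; rewrite lee_pmul2l.
rewrite -!EFinM -EFinD lte_fin.
(* Strictness comes from multiplying [s < eps] by this positive factor. Positivity follows from
   [(alpha + beta)^2 + (alpha - beta)^2 = 2 (alpha^2 + beta^2)]. *)
have ab2 : 0 < alpha ^+ 2 + beta ^+ 2.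
  by have := mulr_gt0 ab0 ab0; have := sqr_ge0 (alpha - beta); lra.
by move: s_eps; rewrite -subr_gt0 => /(mulr_gt0 ab2); lra.
Qed.
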